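(* Let $\alpha>-1$, $\beta>-1$ and, for $n\ge 1$, put $$\gamma_n=\frac{2(\beta+n+1)(n+\alpha+\beta+1)}{(2n+\alpha+\beta+1)(2n+\alpha+\beta)} .$$ Then: (i) $(\gamma_n)$ satisfies, for all $n\ge2$, the nonlinear difference equation $$c^c_{n+1}-c^c_n+\gamma_n-\gamma_{n+1}-\frac{\lambda^c_{n+1}}{\gamma_n}+\frac{\lambda^c_n}{\gamma_{n-1}}=0 .$$ (ii) For all $n\ge1$, the quasi-Christoffel Jacobi polynomial $J^{QC}_n(x;-1)=\mathcal P^{(\alpha,\beta+1)}_n(x)+\gamma_n\mathcal P^{(\alpha,\beta+1)}_{n-1}(x)$ equals $(x+1)\,\mathcal P^{(\alpha,\beta+2)}_{n-1}(x)$. (iii) For all $n\ge2$, $$J^{QC}_{n+1}(x;-1)=(x-c^{qc}_{n+1})J^{QC}_n(x;-1)-\lambda^{qc}_{n+1}J^{QC}_{n-1}(x;-1),$$ where $$\lambda^{qc}_{n+1}=\frac{4(n-1)(n+\alpha-1)(n+\beta+1)(n+\alpha+\beta+1)}{(2n+\alpha+\beta)^2(2n+\alpha+\beta+1)(2n+\alpha+\beta-1)},\qquad c^{qc}_{n+1}=\frac{(\beta+2)^2-\alpha^2}{(2n+\alpha+\beta)(2n+\alpha+\beta+2)} .$$ (iv) The polynomials $J^{QC}_n(x;-1)$, $n\ge1$, are orthogonal with respect to $(1-x)^{\alpha}(1+x)^{\beta}\,dx$ on $(-1,1)$.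
   Context: For $a,b>-1$, $\mathcal P^{(a,b)}_n(x)$ denotes the monic Jacobi polynomial of degree $n$, i.e. the monic polynomials orthogonal on $(-1,1)$ with respect to the weight $(1-x)^a(1+x)^b$. The polynomials $\mathcal P^{(\alpha,\beta+1)}_n$ (the Christoffel transform at $-1$ of $\mathcal P^{(\alpha,\beta)}_n$) satisfy $\mathcal P^{(\alpha,\beta+1)}_{n+1}(x)=(x-c^c_{n+1})\mathcal P^{(\alpha,\beta+1)}_n(x)-\lambda^c_{n+1}\mathcal P^{(\alpha,\beta+1)}_{n-1}(x)$ for $n\ge1$ with $$\lambda^c_{n+1}=\frac{4n(n+\alpha)(n+\beta+1)(n+\alpha+\beta+1)}{(2n+\alpha+\beta+1)^2(2n+\alpha+\beta+2)(2n+\alpha+\beta)},\qquad c^c_{n+1}=\frac{(\beta+1)^2-\alpha^2}{(2n+\alpha+\beta+1)(2n+\alpha+\beta+3)} .$$ A family of polynomials $(p_n)_{n\ge n_0}$ is orthogonal with respect to a measure $\mu$ if $\int p_np_m\,d\mu$ converges absolutely for all $n,m\ge n_0$, is $0$ for $n\ne m$ and is nonzero for $n=m$. *)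

(* Defs.v *)
(* MathComp-Analysis *)
From mathcomp Require Import all_boot all_order all_algebra.
From mathcomp Require Import all_classical all_reals all_analysis.
Set Implicit Arguments.
Unset Strict Implicit.
Unset Printing Implicit Defensive.
Import Order.TTheory GRing.Theory Num.Theory.
Import numFieldNormedType.Exports.
Local Open Scope classical_set_scope.
Local Open Scope ring_scope.

(* The measure is w(x) dx on D, so that an integral against it is the Lebesgue
   integral over D of the integrand times w. Absolute convergence is Lebesgue
   integrability. *)
Definition orthogonal_family (R : realType) (D : set R) (w : R -> R)
    (n0 : nat) (p : nat -> {poly R}) : Prop :=
  forall n m : nat, (n0 <= n)%N -> (n0 <= m)%N ->
    let f (x : R) := ((p n).[x] * (p m).[x] * w x)%:E in
    [/\ (@lebesgue_measure R).-integrable D f,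
        n <> m -> (\int[@lebesgue_measure R]_(x in D) f x)%E = 0%:E
      & n = m -> (\int[@lebesgue_measure R]_(x in D) f x)%E <> 0%:E].

Definition jacobi_weight (R : realType) (a b : R) (x : R) : R :=
  (1 - x) `^ a * (1 + x) `^ b.

Definition is_monic_jacobi (R : realType) (a b : R) (p : nat -> {poly R}) :
    Prop :=
  (forall n, p n \is monic /\ size (p n) = n.+1) /\
  orthogonal_family `]-1, 1[ (jacobi_weight a b) 0 p.

(* The family is unique, and it exists for a, b > -1; the default value is used
   only for other parameters. *)
Definition monic_jacobi (R : realType) (a b : R) : nat -> {poly R} :=
  xget (fun=> 0) [set p | is_monic_jacobi a b p].

(* The recurrence coefficients carry the index of their name: c_{n+1} and
   lambda_{n+1}, given by formulas in n, are the values at k = n.+1, so only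
   k >= 2 is meaningful. *)
Definition lambda_c (R : realType) (alpha beta : R) (k : nat) : R :=
  let n := k.-1%:R in
  4 * n * (n + alpha) * (n + beta + 1) * (n + alpha + beta + 1) /
  ((2 * n + alpha + beta + 1) ^+ 2 * (2 * n + alpha + beta + 2) *
   (2 * n + alpha + beta)).

Definition c_c (R : realType) (alpha beta : R) (k : nat) : R :=
  let n := k.-1%:R in
  ((beta + 1) ^+ 2 - alpha ^+ 2) /
  ((2 * n + alpha + beta + 1) * (2 * n + alpha + beta + 3)).

Definition lambda_qc (R : realType) (alpha beta : R) (k : nat) : R :=
  let n := k.-1%:R in
  4 * (n - 1) * (n + alpha - 1) * (n + beta + 1) * (n + alpha + beta + 1) /
  ((2 * n + alpha + beta) ^+ 2 * (2 * n + alpha + beta + 1) *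
   (2 * n + alpha + beta - 1)).

Definition c_qc (R : realType) (alpha beta : R) (k : nat) : R :=
  let n := k.-1%:R in
  ((beta + 2) ^+ 2 - alpha ^+ 2) /
  ((2 * n + alpha + beta) * (2 * n + alpha + beta + 2)).

Definition gamma_qc (R : realType) (alpha beta : R) (k : nat) : R :=
  let n := k%:R in
  2 * (beta + n + 1) * (n + alpha + beta + 1) /
  ((2 * n + alpha + beta + 1) * (2 * n + alpha + beta)).

(* Meaningful for n >= 1. *)
Definition quasi_christoffel_jacobi (R : realType) (alpha beta : R) (n : nat) :
    {poly R} :=
  monic_jacobi alpha (beta + 1) n +
  gamma_qc alpha beta n *: monic_jacobi alpha (beta + 1) n.-1.

(* Main.v *)
Require Import Defs.
From HB Require Import structures.
From mathcomp Require Import all_boot all_order all_algebra.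
From mathcomp Require Import all_classical all_reals all_analysis.
From mathcomp Require Import measurable_realfun.
From mathcomp Require Import ring lra.
Set Implicit Arguments.
Unset Strict Implicit.
Unset Printing Implicit Defensive.
Import Order.TTheory GRing.Theory Num.Theory.
Import numFieldNormedType.Exports.
Local Open Scope classical_set_scope.
Local Open Scope ring_scope.

(** The weight w of parameters (a, b) satisfies the Pearson equation
    ((1 - x^2) w q)' = ((1 - x^2) q' + (b - a - (a + b + 2) x) q) w, and
    (1 - x^2) w vanishes at both ends of (-1, 1) when a, b > -1. Integrating
    ([integral_jacobi_pearson]) shows that the differential operator
    D p = (1 - x^2) p'' + (b - a - (a + b + 2) x) p' is symmetric for the inner
    product given by w ([jacobi_operator_sym]). As D does not raise degrees,
    the degree n orthogonal polynomial is an eigenvector of D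
    ([orthopoly_eigen]), and comparing coefficients in the eigenvalue equation
    yields its coefficients in degrees n - 1 and n - 2.

    These coefficients determine the formulas. A polynomial of degree
    less than n that is orthogonal to all polynomials of degree less than n
    is zero ([orthogonal_small_eq0]); so in an identity between polynomials
    orthogonal to low degrees only the topmost coefficients need checking.
    The three-term recurrence ([jacobi_recurrence]) needs two coefficients
    below the leading one. The identity between the families for (a, b) and
    (a, b + 1) ([jacobi_christoffel]) needs one: if q of degree n is orthogonal
    for (1 + x) w to degrees less than n, then so is (1 + x) q for w.

    With a = alpha and b = beta + 1 the latter is part (ii), which reduces (iii) to the
    recurrence for (alpha, beta + 2), and (iv) to the orthogonality of that
    family, since (1 + x)^2 (1 + x)^beta = (1 + x)^(beta + 2). Part (i) is an
    identity of rational functions.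

    The Jacobi family itself exists because the integral against w is finite on
    polynomials ([integrable_horner_jacobi_weight]) and definite
    ([integral_sqr_jacobi_weight_eq0]), so that Gram-Schmidt orthogonalization
    applies ([orthopoly_exists]). *)

(** * Orthogonal polynomials for a definite functional *)

Section OrthogonalPolynomials.
Variables (F : fieldType) (L : {scalar {poly F}}).
Implicit Types (p q r : {poly F}) (n : nat).

Definition orthopoly n p :=
  [/\ p \is monic, size p = n.+1 & forall q, (size q <= n)%N -> L (p * q) = 0].

Lemma orthopoly_lead n p : orthopoly n p -> p`_n = 1.
Proof. by case=> /monicP + sp _; rewrite lead_coefE sp. Qed.

Lemma size_sub_lead_coef n p q : p \is monic -> size p = n.+1 ->
  (size q <= n.+1)%N -> (size (q - q`_n *: p)%R <= n)%N.
Proof.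
move=> mp sp sq; apply/leq_sizeP => j; rewrite leq_eqVlt => /predU1P[<-|nj].
  by move: mp; rewrite coefB coefZ monicE lead_coefE sp => /eqP ->;
    rewrite mulr1 subrr.
by rewrite coefB coefZ !(@nth_default _ _ _ j) ?mulr0 ?subrr ?sp ?(leq_trans sq).
Qed.

(** The first n members of such a family span the polynomials of degree less
    than n: leading terms are stripped one after the other. *)
Lemma orthopoly_pairwise (p : nat -> {poly F}) :
  (forall n, p n \is monic /\ size (p n) = n.+1) ->
  (forall n m, n <> m -> L (p n * p m) = 0) ->
  forall n, orthopoly n (p n).
Proof.
move=> hp orth n; split; [exact: (hp n).1|exact: (hp n).2|].
suff H m q : (m <= n)%N -> (size q <= m)%N -> L (p n * q) = 0.
  by move=> q; apply: H.
elim: m q => [|m IH] q mn sq.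
  by move: sq; rewrite leqn0 size_poly_eq0 => /eqP->; rewrite mulr0 linear0.
have [mm sm] := hp m.
rewrite -[q](subrK (q`_m *: p m)) mulrDr linearD /=.
rewrite IH ?(ltnW mn)//; last exact: size_sub_lead_coef.
rewrite -scalerAr linearZ /= orth ?mulr0 ?addr0//.
by move=> nm; rewrite nm ltnn in mn.
Qed.

Hypothesis definite : forall p, L (p * p) = 0 -> p = 0.

(** Such a p is orthogonal to itself. *)
Lemma orthogonal_small_eq0 n p : (size p <= n)%N ->
  (forall q, (size q <= n)%N -> L (p * q) = 0) -> p = 0.
Proof. by move=> sp orth; apply/definite/orth. Qed.

(** Gram-Schmidt: the projection onto degrees at most n adds, to the projection
    onto degrees less than n, the component along the error e made when
    projecting 'X^n. *)
Lemma orthogonal_projection n (f : {poly F}) :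
  exists2 p : {poly F}, (size p <= n)%N &
    forall q, (size q <= n)%N -> L ((f - p) * q) = 0.
Proof.
elim: n f => [|n IH] f.
  exists 0; first by rewrite size_poly0.
  by move=> q; rewrite leqn0 size_poly_eq0 => /eqP->; rewrite mulr0 linear0.
have [g sg og] := IH 'X^n; have [p sp op] := IH f.
pose e := 'X^n - g.
have se : size e = n.+1 by rewrite size_polyDl size_polyXn// size_polyN ltnS.
have me : e \is monic.
  by rewrite monicE lead_coefDl ?lead_coefXn// size_polyN size_polyXn ltnS.
have e2 : L (e * e) != 0.
  by apply/eqP => /definite e0; move: se; rewrite e0 size_poly0.
exists (p + (L ((f - p) * e) / L (e * e)) *: e).
  rewrite (leq_trans (size_polyD _ _))// geq_max (leqW sp)/=.
  by rewrite (leq_trans (size_scale_leq _ _)) ?se.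
move=> q sq; set c := _ / _.
have sr := size_sub_lead_coef me se sq.
set r := q - _ in sr; have -> : q = r + q`_n *: e by rewrite subrK.
(* r has degree less than n, so it is orthogonal to f - p and to e. *)
have -> : (f - (p + c *: e)) * (r + q`_n *: e) =
   (f - p) * r - c *: (e * r) + q`_n *: ((f - p) * e - c *: (e * e)).
  by rewrite -!mul_polyC; ring.
rewrite linearD linearB linearZ /= op// og// mulr0 subr0 add0r.
by rewrite linearZ linearB linearZ /= divfK// subrr mulr0.
Qed.

Lemma orthopoly_exists n : exists p, orthopoly n p.
Proof.
have [g sg og] := orthogonal_projection n 'X^n.
exists ('X^n - g); split=> //.
- by rewrite monicE lead_coefDl ?lead_coefXn// size_polyN size_polyXn ltnS.
- by rewrite size_polyDl size_polyXn// size_polyN ltnS.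
Qed.

(** Whatever c and l are, the difference of the two sides is orthogonal to
    degrees less than n, because the multiplication by 'X - c can be moved to
    the other factor. Suitable c and l only have to cancel its coefficients of
    degree n and above. *)
Lemma orthopoly_recurrence n p0 p1 p2 (c l : F) :
  orthopoly n p0 -> orthopoly n.+1 p1 -> orthopoly n.+2 p2 ->
  (size (p2 - (('X - c%:P) * p1 - l *: p0))%R <= n)%N ->
  p2 = ('X - c%:P) * p1 - l *: p0.
Proof.
move=> [_ _ o0] [_ _ o1] [_ _ o2] sr; apply/eqP; rewrite -subr_eq0; apply/eqP.
apply: (orthogonal_small_eq0 sr) => q sq.
have -> : (p2 - (('X - c%:P) * p1 - l *: p0)) * q =
  p2 * q - p1 * (('X - c%:P) * q) + l *: (p0 * q) by rewrite -!mul_polyC; ring.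
rewrite linearD linearB linearZ /= o0// mulr0 addr0 o1 ?subr0.
  by apply: o2; rewrite (leq_trans sq)// (leq_trans (leqnSn _)).
by rewrite (leq_trans (size_polyMleq _ _))// size_XsubC.
Qed.

(** Orthogonality for L' of q0 is orthogonality for L of u * q0, so both sides
    are orthogonal to degrees less than n. *)
Lemma orthopoly_quasi_christoffel (L' : {scalar {poly F}}) (u : {poly F})
    n p0 p1 q0 (g : F) :
  (forall p, L' p = L (u * p)) ->
  orthopoly n p0 -> orthopoly n.+1 p1 ->
  (forall q, (size q <= n)%N -> L' (q0 * q) = 0) ->
  (size (u * q0 - (p1 + g *: p0))%R <= n)%N ->
  p1 + g *: p0 = u * q0.
Proof.
move=> LL' [_ _ o0] [_ _ o1] o' sr; apply/esym/eqP; rewrite -subr_eq0; apply/eqP.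
apply: (orthogonal_small_eq0 sr) => q sq.
have -> : (u * q0 - (p1 + g *: p0)) * q =
  u * (q0 * q) - p1 * q - g *: (p0 * q) by rewrite -!mul_polyC; ring.
by rewrite linearB linearB linearZ /= -LL' o'// o0// o1 ?(leqW sq)// mulr0 !subr0.
Qed.

End OrthogonalPolynomials.

(** * The Jacobi differential operator *)

Section JacobiOperator.
Variables (F : fieldType) (a b : F).
Implicit Types (p q r : {poly F}) (n : nat).

(** The polynomial (w * (1 - 'X^2) * r)' / w, where w is the Jacobi weight of
    parameters a and b. *)
Definition jacobi_pearson r :=
  (1 - 'X^2) * r^`() + ((b - a)%:P - (a + b + 2) *: 'X) * r.

Definition jacobi_operator p :=
  (1 - 'X^2) * p^`()^`() + ((b - a)%:P - (a + b + 2) *: 'X) * p^`().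

Lemma jacobi_operator_wronskian p q :
  jacobi_operator p * q - p * jacobi_operator q =
  jacobi_pearson (p^`() * q - p * q^`()).
Proof.
by rewrite /jacobi_operator /jacobi_pearson !poly.derivE -!mul_polyC; ring.
Qed.

Lemma coef_jacobi_operator p n : (jacobi_operator p)`_n =
  - (n%:R * (n%:R + a + b + 1)) * p`_n + n.+1%:R * (b - a) * p`_n.+1
  + n.+2%:R * n.+1%:R * p`_n.+2.
Proof.
rewrite /jacobi_operator mulrBl mulrBl mul1r -scalerAl.
rewrite !(coefD, coefN, coefZ, coefXM, coefXnM, coefCM, coef_deriv).
by case: n => [|[|n]]; rewrite [LHS]/= ?subSS ?subn0; ring.
Qed.

Lemma size_jacobi_operator p : (size (jacobi_operator p) <= size p)%N.
Proof.
apply/leq_sizeP => j sj; rewrite coef_jacobi_operator.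
by rewrite !nth_default ?mulr0 ?addr0 ?(leq_trans sj) ?leqW.
Qed.

Variable L : {scalar {poly F}}.
Hypothesis definite : forall p, L (p * p) = 0 -> p = 0.
Hypothesis pearson : forall r, L (jacobi_pearson r) = 0.

(** The difference of the two integrands is the derivative of (1 - x^2) w
    times the Wronskian of p and q. *)
Lemma jacobi_operator_sym p q :
  L (jacobi_operator p * q) = L (p * jacobi_operator q).
Proof.
by apply/eqP; rewrite -subr_eq0 -linearB /= jacobi_operator_wronskian pearson.
Qed.

(** The difference of the two sides has degree less than n, by the choice of
    the eigenvalue, and it is orthogonal to lower degrees since the operator is
    symmetric and does not raise degrees. *)
Lemma orthopoly_eigen n p : orthopoly L n p ->
  jacobi_operator p = - (n%:R * (n%:R + a + b + 1)) *: p.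
Proof.
move=> [mp sp orth]; apply/eqP; rewrite -subr_eq0; apply/eqP.
have /(orthogonal_small_eq0 definite) : (size (jacobi_operator p -
    - (n%:R * (n%:R + a + b + 1)) *: p)%R <= n)%N.
  have := size_jacobi_operator p; rewrite sp => /(size_sub_lead_coef mp sp).
  rewrite coef_jacobi_operator !(@nth_default _ _ _ n.+1) ?sp//.
  rewrite !(@nth_default _ _ _ n.+2) ?sp//.
  by move: mp; rewrite monicE lead_coefE sp => /eqP ->; rewrite mulr1 !mulr0 !addr0.
apply=> // q sq; rewrite mulrBl -scalerAl linearB linearZ /= orth// mulr0 subr0.
by rewrite jacobi_operator_sym orth// (leq_trans (size_jacobi_operator q)).
Qed.

(** Coefficient of degree n in the eigenvalue equation; the factor on the left
    is the difference of two consecutive eigenvalues. *)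
Lemma orthopoly_coef1 n p : orthopoly L n.+1 p ->
  (2 * n%:R + a + b + 2) * p`_n = n.+1%:R * (a - b).
Proof.
move=> op; have [_ sp _] := op; have pn1 := orthopoly_lead op.
have := congr1 (fun r : {poly F} => r`_n) (orthopoly_eigen op).
rewrite coef_jacobi_operator coefZ pn1 (nth_default 0 (n:=n.+2)) ?sp//.
rewrite -!natr1 => /eqP; rewrite -subr_eq0 => /eqP E.
by apply/subr0_eq; rewrite -[RHS]E; ring.
Qed.

Lemma orthopoly_coef2 n p : orthopoly L n.+2 p ->
  2 * (2 * n%:R + a + b + 3) * p`_n =
  n.+1%:R * (a - b) * p`_n.+1 - n.+2%:R * n.+1%:R.
Proof.
move=> op; have pn1 := orthopoly_lead op.
have := congr1 (fun r : {poly F} => r`_n) (orthopoly_eigen op).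
rewrite coef_jacobi_operator coefZ pn1 -!natr1.
move=> /eqP; rewrite -subr_eq0 => /eqP E.
by apply/subr0_eq; rewrite -[RHS]E; ring.
Qed.

End JacobiOperator.

(** * Recurrence and Christoffel transform from leading coefficients *)

Lemma eq_divl (F : fieldType) (u v w : F) : u != 0 -> u * v = w -> v = w / u.
Proof. by move=> u0 <-; rewrite mulrC mulKf. Qed.

Section JacobiRecurrence.
Variables (F : fieldType) (a b : F).
Variable L : {scalar {poly F}}.
Hypothesis definite : forall p, L (p * p) = 0 -> p = 0.
Hypothesis pearson : forall r, L (jacobi_pearson a b r) = 0.

(** The multiplication by 'X shifts the indices, so that the formula for the
    second coefficient also covers n = 0, where both sides vanish; likewise in
    the next lemma. *)
Lemma orthopoly_coefX1 n p : orthopoly L n p ->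
  (2 * n%:R + a + b) * ('X * p)`_n = n%:R * (a - b).
Proof.
rewrite coefXM; case: n => [|n] op; first by rewrite mulr0 mul0r.
rewrite -(orthopoly_coef1 definite pearson op) -natr1 /=; ring.
Qed.

Lemma orthopoly_coefX2 n p : orthopoly L n.+1 p ->
  2 * (2 * n%:R + a + b + 1) * ('X * p)`_n =
  n%:R * (a - b) * p`_n - n.+1%:R * n%:R.
Proof.
rewrite coefXM; case: n => [|n] op; first by rewrite !(mulr0, mul0r) subrr.
rewrite -(orthopoly_coef2 definite pearson op) -natr1 /=; ring.
Qed.

(** [orthopoly_recurrence] leaves three coefficients to compare: degree n + 2,
    where both sides are monic, degree n + 1, which fixes c, and degree n,
    which fixes l. *)
Lemma jacobi_recurrence n p0 p1 p2 (k := n%:R + 1) :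
  2 * k + a + b - 1 != 0 -> 2 * k + a + b != 0 -> 2 * k + a + b + 1 != 0 ->
  2 * k + a + b + 2 != 0 -> (2 : F) != 0 ->
  orthopoly L n p0 -> orthopoly L n.+1 p1 -> orthopoly L n.+2 p2 ->
  p2 = ('X - ((b ^+ 2 - a ^+ 2) /
              ((2 * k + a + b) * (2 * k + a + b + 2)))%:P) * p1 -
       (4 * k * (k + a) * (k + b) * (k + a + b) /
        ((2 * k + a + b) ^+ 2 * (2 * k + a + b + 1) * (2 * k + a + b - 1))) *: p0.
Proof.
move=> d1 d2 d3 d4 d5 o0 o1 o2.
have [[_ s0 _] [_ s1 _] [_ s2 _]] := And3 o0 o1 o2.
have l0 := orthopoly_lead o0; have l1 := orthopoly_lead o1.
have l2 := orthopoly_lead o2.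
have e1 : p1`_n = k * (a - b) / (2 * k + a + b).
  apply: eq_divl => //; rewrite /k natr1.
  by rewrite -(orthopoly_coef1 definite pearson o1) -natr1; ring.
have e2 : p2`_n.+1 = (k + 1) * (a - b) / (2 * k + a + b + 2).
  apply: eq_divl => //; rewrite /k !natr1.
  by rewrite -(orthopoly_coef1 definite pearson o2) -!natr1; ring.
have f1 : ('X * p1)`_n = ((k - 1) * (a - b) * p1`_n - k * (k - 1)) /
    (2 * (2 * k + a + b - 1)).
  apply: eq_divl; first by rewrite mulf_neq0.
  rewrite /k addrK natr1 -(orthopoly_coefX2 o1) -natr1; ring.
have f2 : p2`_n = (k * (a - b) * p2`_n.+1 - (k + 1) * k) /
    (2 * (2 * k + a + b + 1)).
  apply: eq_divl; first by rewrite mulf_neq0.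
  rewrite /k !natr1 -(orthopoly_coef2 definite pearson o2) -!natr1; ring.
apply: (orthopoly_recurrence definite o0 o1 o2); apply/leq_sizeP => j.
rewrite mulrBl !(coefB, coefCM, coefZ).
rewrite leq_eqVlt => /predU1P[<-|].
  rewrite l0 f2 f1 e2 e1; clearbody k.
  by field; rewrite ?d1 ?d2 ?d3 ?d4 ?d5.
rewrite leq_eqVlt => /predU1P[<-|].
  rewrite coefXM /= l1 e2 e1 nth_default ?s0// mulr0.
  by field; rewrite ?d1 ?d2 ?d3 ?d4 ?d5.
rewrite leq_eqVlt => /predU1P[<-|nj].
  rewrite coefXM /= l1 l2 (@nth_default _ _ p1) ?s1// nth_default ?s0//.
  by rewrite !mulr0 !subr0 subrr.
rewrite coefXM; case: j nj => // j nj.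
by rewrite /= !nth_default ?mulr0 ?subrr ?s0 ?s1 ?s2 // ltnW// ltnW.
Qed.

End JacobiRecurrence.

(** [orthopoly_quasi_christoffel] leaves two coefficients to compare: degree
    n + 1, where both sides are monic, and degree n, which fixes the factor of
    p0. *)
Lemma jacobi_christoffel (F : fieldType) (a b : F) (L L' : {scalar {poly F}})
    n p0 p1 q0 (k := n%:R + 1) :
  (forall p, L (p * p) = 0 -> p = 0) ->
  (forall r, L (jacobi_pearson a b r) = 0) ->
  (forall p, L' (p * p) = 0 -> p = 0) ->
  (forall r, L' (jacobi_pearson a (b + 1) r) = 0) ->
  (forall p, L' p = L (('X + 1) * p)) ->
  2 * k + a + b - 1 != 0 -> 2 * k + a + b != 0 ->
  orthopoly L n p0 -> orthopoly L n.+1 p1 -> orthopoly L' n q0 ->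
  p1 + (2 * (k + b) * (k + a + b) /
         ((2 * k + a + b) * (2 * k + a + b - 1))) *: p0 = ('X + 1) * q0.
Proof.
move=> def pear def' pear' LL' d1 d2 o0 o1 oq.
have [[_ s0 _] [_ s1 _] [_ sq orthq]] := And3 o0 o1 oq.
have l0 := orthopoly_lead o0; have l1 := orthopoly_lead o1.
have lq := orthopoly_lead oq.
have e1 : p1`_n = k * (a - b) / (2 * k + a + b).
  apply: eq_divl => //; rewrite /k natr1.
  by rewrite -(orthopoly_coef1 def pear o1) -natr1; ring.
have e2 : ('X * q0)`_n = (k - 1) * (a - b - 1) / (2 * k + a + b - 1).
  apply: eq_divl => //; rewrite /k addrK (_ : a - b - 1 = a - (b + 1)); last ring.
  by rewrite -(orthopoly_coefX1 def' pear' oq); ring.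
apply: (orthopoly_quasi_christoffel def LL' o0 o1 orthq); apply/leq_sizeP => j.
rewrite mulrDl mul1r !(coefB, coefD, coefZ).
rewrite leq_eqVlt => /predU1P[<-|].
  rewrite lq l0 e2 e1; clearbody k.
  by field; rewrite ?d1 ?d2.
rewrite leq_eqVlt => /predU1P[<-|nj].
  by rewrite coefXM /= lq l1 !nth_default ?s0 ?sq// mulr0 !addr0 subrr.
rewrite coefXM; case: j nj => // j nj.
by rewrite /= !nth_default ?mulr0 ?addr0 ?subrr ?s0 ?s1 ?sq // ltnW// ltnW.
Qed.

(** * Primitives and integrals on the open interval *)

Section IntegrationOnOpenInterval.
Variable R : realType.
Local Notation mu := (@lebesgue_measure R).
Local Notation I := (`](-1)%R, 1%R[%classic : set R).
Implicit Types (f F : R -> R) (n : nat).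

Lemma is_derive_continuous (f : R -> R) (x df : R) :
  is_derive x (1 : R) f df -> {for x, continuous f}.
Proof.
by move=> h; apply/differentiable_continuous/derivable1_diffP; exact: ex_derive.
Qed.

(** The functions to integrate may be unbounded near -1 and 1, so the
    fundamental theorem of calculus is applied on closed segments that
    increase to the open interval. *)
Definition exhaust_end n : R := 1 - n.+2%:R^-1.

Lemma exhaust_end_itv n : 0 < exhaust_end n < 1.
Proof.
by rewrite /exhaust_end subr_gt0 invf_lt1 ?ltr1n//= gtrBl invr_gt0.
Qed.

Definition exhaust n : set R := `[- exhaust_end n, exhaust_end n].

Lemma subset_exhaust n : exhaust n `<=` `]-1, 1[.
Proof.
have /andP[e0 e1] := exhaust_end_itv n.
by move=> x; rewrite /exhaust /= !in_itv/= => /andP[h1 h2]; apply/andP; split; lra.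
Qed.

Lemma nondecreasing_exhaust : nondecreasing_seq exhaust.
Proof.
move=> m n mn; rewrite subsetEset => x; rewrite /exhaust /= !in_itv /=.
have : exhaust_end m <= exhaust_end n.
  by rewrite lerD2l lerN2 lef_pV2 ?posrE// ler_nat !ltnS.
by move=> h /andP[h1 h2]; apply/andP; split; lra.
Qed.

Lemma cvg_inv_natSS : (n.+2%:R^-1 : R) @[n --> \oo] --> (0 : R).
Proof. by have := @cvg_harmonic R; rewrite -cvg_shiftS. Qed.

Lemma cvg_exhaust_end : exhaust_end n @[n --> \oo] --> (1 : R).
Proof.
by rewrite -[X in _ --> X]subr0; apply: cvgB; [exact: cvg_cst|exact: cvg_inv_natSS].
Qed.

Lemma near_exhaust (x : R) : `]-1, 1[%classic x ->
  \forall n \near \oo, exhaust n x.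
Proof.
rewrite /= in_itv/= => /andP[h1 h2].
have x1 : `|x| < 1 by rewrite ltr_norml h1.
have xe : \forall n \near \oo, `|x| < exhaust_end n.
  exact: (cvgr_gt 1 cvg_exhaust_end).
apply: filterS xe => n xn.
by rewrite /exhaust/= in_itv/= -ler_norml ltW.
Qed.

Lemma bigcup_exhaust : \bigcup_n exhaust n = `]-1, 1[%classic.
Proof.
apply/seteqP; split=> [x [n _]|x /near_exhaust [n _ /(_ n (leqnn _)) xn]].
  exact: subset_exhaust.
by exists n.
Qed.

Lemma FTC_exhaust n f F :
  {in `]-1, 1[, continuous f} ->
  {in `]-1, 1[, forall x : R, is_derive x (1 : R) F (f x)} ->
  (\int[mu]_(x in exhaust n) (f x)%:E)%E =
  (F (exhaust_end n) - F (- exhaust_end n))%:E.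
Proof.
move=> cf dF; have /andP[e0 e1] := exhaust_end_itv n.
have sub (x : R) : x \in `[- exhaust_end n, exhaust_end n] -> x \in `]-1, 1[.
  exact: subset_exhaust.
have subo (x : R) : x \in `]- exhaust_end n, exhaust_end n[ -> x \in `]-1, 1[.
  by move=> /subset_itv_oo_cc /sub.
have cF (x : R) : x \in `]-1, 1[ -> {for x, continuous F}.
  by move=> /dF /is_derive_continuous.
rewrite EFinB; apply: continuous_FTC2.
- by lra.
- by apply: continuous_in_subspaceT => x; rewrite inE => /sub /cf.
- split.
  + by move=> x /subo /dF h; exact: ex_derive.
  + by apply: cvg_at_right_filter; apply: cF; rewrite in_itv/=; apply/andP; split; lra.
  + by apply: cvg_at_left_filter; apply: cF; rewrite in_itv/=; apply/andP; split; lra.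
- by move=> x /subo /dF h; rewrite derive1E; exact: derive_val.
Qed.

Lemma continuous_itv_measurable f : {in `]-1, 1[, continuous f} ->
  measurable_fun I f.
Proof.
move=> cf; apply: open_continuous_measurable_fun => //.
by move=> x; rewrite inE => /cf.
Qed.

(** By monotone convergence the integral is the limit of the integrals over the
    exhausting segments, each of which is at most M + M. *)
Lemma integrable_bounded_primitive f F (M : R) :
  {in `]-1, 1[, continuous f} ->
  {in `]-1, 1[, forall x : R, is_derive x (1 : R) F (f x)} ->
  {in `]-1, 1[, forall x : R, 0 <= f x} ->
  {in `]-1, 1[, forall x : R, `|F x| <= M} ->
  mu.-integrable I (EFin \o f).
Proof.
move=> cf dF f0 FM; apply/integrableP; split.
  by apply/measurable_EFinP; exact: continuous_itv_measurable.
rewrite (@eq_integral _ _ _ mu _ (EFin \o f)); last first.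
  by move=> x; rewrite inE => /f0 fx0; rewrite /= ger0_norm.
rewrite -bigcup_exhaust.
have mf n : measurable_fun (exhaust n) (EFin \o f).
  apply/measurable_EFinP; apply: measurable_funS (continuous_itv_measurable cf) => //.
  exact: subset_exhaust.
have f0' n x : exhaust n x -> (0 <= (f x)%:E)%E.
  by move=> /subset_exhaust /f0; rewrite lee_fin.
have : (\int[mu]_(x in exhaust n) (f x)%:E)%E @[n --> \oo] -->
    (\int[mu]_(x in \bigcup_n exhaust n) (f x)%:E)%E.
  apply: ge0_nondecreasing_set_cvg_integral => //.
  - exact: nondecreasing_exhaust.
  - by move=> i; exact: measurable_itv.
move=> /cvg_lim <-//; apply: (@le_lt_trans _ _ (M + M)%:E); last exact: ltry.
apply: lime_le.
  apply: ereal_nondecreasing_is_cvgn.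
  apply: ge0_nondecreasing_set_nondecreasing_integral => //.
  - exact: nondecreasing_exhaust.
  - by move=> i; exact: measurable_itv.
apply: nearW => n; rewrite /= (FTC_exhaust _ cf dF) lee_fin.
have /andP[e0 e1] := exhaust_end_itv n.
have h1 : `|F (exhaust_end n)| <= M by apply: FM; rewrite in_itv/=; apply/andP; split; lra.
have h2 : `|F (- exhaust_end n)| <= M by apply: FM; rewrite in_itv/=; apply/andP; split; lra.
by rewrite (le_trans (ler_norm _))// (le_trans (ler_normB _ _))// lerD.
Qed.

(** The integrals of f over the exhausting segments are differences of values
    of F; by dominated convergence they tend to the integral of f. *)
Lemma integral_primitive f F (l1 l2 : R) :
  {in `]-1, 1[, continuous f} ->
  {in `]-1, 1[, forall x : R, is_derive x (1 : R) F (f x)} ->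
  mu.-integrable I (EFin \o f) ->
  F (exhaust_end n) @[n --> \oo] --> l1 ->
  F (- exhaust_end n) @[n --> \oo] --> l2 ->
  (\int[mu]_(x in I) (f x)%:E)%E = (l1 - l2)%:E.
Proof.
move=> cf dF intf cF1 cF2.
pose g n := (EFin \o f) \_ (exhaust n).
have mf : measurable_fun I (EFin \o f).
  by apply/measurable_EFinP; exact: continuous_itv_measurable.
have mg n : measurable_fun I (g n).
  apply/(measurable_restrict (EFin \o f) (measurable_itv _) (measurable_itv _)).
  apply: measurable_funS mf => //; exact: subIsetl.
have [] := @dominated_convergence _ _ R mu I (measurable_itv _)
   g (EFin \o f) (abse \o (EFin \o f)) mg mf.
- apply: aeW => x xD.
  apply: cvg_near_cst; apply: filterS (near_exhaust xD) => n xn.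
  by rewrite /g patchE mem_set.
- exact: integrable_abse.
- apply: aeW => x n _; rewrite /g patchE; case: ifPn => //= _.
  by rewrite lee_fin normr0.
move=> _ _ cvgI.
suff cvgI2 : ((\int[mu]_(x in I) g n x)%E @[n --> \oo] --> (l1 - l2)%:E).
  exact: cvg_unique cvgI cvgI2.
have E n : (\int[mu]_(x in I) g n x)%E =
    (F (exhaust_end n) - F (- exhaust_end n))%:E.
  rewrite -(FTC_exhaust n cf dF) -integral_mkcondr.
  by rewrite setIidr//; exact: subset_exhaust.
under eq_fun do rewrite E.
by apply: cvg_EFin; [exact: nearW|exact: cvgB].
Qed.

End IntegrationOnOpenInterval.

(** * The Jacobi weight *)

Section JacobiWeight.
Variable R : realType.
Local Notation mu := (@lebesgue_measure R).
Local Notation I := (`](-1)%R, 1%R[%classic : set R).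
Implicit Types (a b x : R) (p q : {poly R}).

Lemma itvN11 x : x \in `]-1, 1[ -> 0 < 1 - x /\ 0 < 1 + x.
Proof. by rewrite in_itv/= => /andP[h1 h2]; split; lra. Qed.

Lemma powRD1 a y : 0 < y -> y `^ (a + 1) = y * y `^ a.
Proof.
move=> y0; rewrite powRD ?(gt_eqF y0) ?implybT// powRr1 ?ltW//; ring.
Qed.

Lemma jacobi_weightN a b x : jacobi_weight a b (- x) = jacobi_weight b a x.
Proof. by rewrite /jacobi_weight opprK mulrC. Qed.

Lemma jacobi_weight_gt0 a b x : x \in `]-1, 1[ -> 0 < jacobi_weight a b x.
Proof. by move=> /itvN11[h1 h2]; rewrite mulr_gt0// powR_gt0. Qed.

Lemma jacobi_weightSl a b x : x \in `]-1, 1[ ->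
  jacobi_weight (a + 1) b x = (1 - x) * jacobi_weight a b x.
Proof.
by move=> /itvN11[h1 h2]; rewrite /jacobi_weight powRD1//; ring.
Qed.

Lemma jacobi_weightSr a b x : x \in `]-1, 1[ ->
  jacobi_weight a (b + 1) x = (1 + x) * jacobi_weight a b x.
Proof.
by move=> /itvN11[h1 h2]; rewrite /jacobi_weight powRD1//; ring.
Qed.

Lemma is_derive_powR_1Dx a x : 0 < 1 + x ->
  is_derive x (1 : R) (fun y => (1 + y) `^ (a + 1)) ((a + 1) * (1 + x) `^ a).
Proof.
move=> x0; have := is_derive1_powR (a + 1) x0; rewrite addrK => dp.
have d : is_derive x (1 : R) (cst 1 + id : R -> R) 1.
  by apply: is_derive_eq; rewrite add0r.
have := @is_derive1_comp _ (fun y => y `^ (a + 1)) (cst 1 + id : R -> R) _ _ _ dp d.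
by rewrite mulr1.
Qed.

Lemma is_derive_powR_1Bx a x : 0 < 1 - x ->
  is_derive x (1 : R) (fun y => (1 - y) `^ (a + 1)) (- ((a + 1) * (1 - x) `^ a)).
Proof.
move=> x0; have := is_derive1_powR (a + 1) x0; rewrite addrK => dp.
have d : is_derive x (1 : R) (cst 1 - id : R -> R) (- 1).
  by apply: is_derive_eq; rewrite sub0r.
have := @is_derive1_comp _ (fun y => y `^ (a + 1)) (cst 1 - id : R -> R) _ _ _ dp d.
by rewrite mulrN1.
Qed.

Lemma is_derive_jacobi_weight a b x : x \in `]-1, 1[ ->
  is_derive x (1 : R) (jacobi_weight (a + 1) (b + 1))
    ((b - a - (a + b + 2) * x) * jacobi_weight a b x).
Proof.
move=> xI; have [h1 h2] := itvN11 xI.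
have d1 := is_derive_powR_1Bx a h1; have d2 := is_derive_powR_1Dx b h2.
apply: (is_derive_eq (is_deriveM d1 d2)).
by rewrite /GRing.scale/= /jacobi_weight !powRD1//; ring.
Qed.

Lemma is_derive_horner_jacobi_weight a b q x : x \in `]-1, 1[ ->
  is_derive x (1 : R) (fun y => q.[y] * jacobi_weight (a + 1) (b + 1) y)
    ((jacobi_pearson a b q).[x] * jacobi_weight a b x).
Proof.
move=> xI; have dw := is_derive_jacobi_weight a b xI.
apply: (is_derive_eq (is_deriveM (is_derive_poly q x) dw)).
rewrite /GRing.scale/= jacobi_weightSl// jacobi_weightSr//.
have -> : (jacobi_pearson a b q).[x] =
    (1 - x ^+ 2) * q^`().[x] + (b - a - (a + b + 2) * x) * q.[x].
  by rewrite /jacobi_pearson !hornerE.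
by ring.
Qed.

Lemma continuous_jacobi_weight a b : {in `]-1, 1[, continuous (jacobi_weight a b)}.
Proof.
move=> x xI; have := is_derive_jacobi_weight (a - 1) (b - 1) xI.
by rewrite !subrK => /is_derive_continuous.
Qed.

Lemma continuous_horner_jacobi_weight a b q :
  {in `]-1, 1[, continuous (fun y => q.[y] * jacobi_weight a b y)}.
Proof.
move=> x xI; apply: cvgM; first exact: continuous_horner.
exact: continuous_jacobi_weight.
Qed.

(** The primitive is bounded because a + 1 > 0. *)
Lemma integrable_powR a : -1 < a ->
  mu.-integrable I (EFin \o (fun x : R => (1 + x) `^ a)) /\
  mu.-integrable I (EFin \o (fun x : R => (1 - x) `^ a)).
Proof.
move=> a1.
have bound (y : R) : 0 < y -> y < 2 ->
    `|y `^ (a + 1) / (a + 1)| <= 2 `^ (a + 1) / (a + 1).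
  move=> y0 y2; rewrite ger0_norm; last first.
    by rewrite divr_ge0 ?powR_ge0//; lra.
  rewrite ler_pM2r ?invr_gt0; last by lra.
  by apply: ge0_ler_powR; rewrite ?nnegrE; lra.
split.
- apply: (@integrable_bounded_primitive _ _
    (fun x : R => (1 + x) `^ (a + 1) / (a + 1)) (2 `^ (a + 1) / (a + 1))).
  + move=> x /itvN11[h1 h2]; have := is_derive_powR_1Dx (a - 1) h2.
    by rewrite subrK => /is_derive_continuous.
  + move=> x /itvN11[h1 h2].
    under eq_fun do rewrite mulrC.
    apply: (is_derive_eq (is_deriveZ (a + 1)^-1 (is_derive_powR_1Dx a h2))).
    by rewrite /GRing.scale/= mulKf//; lra.
  + by move=> x _; exact: powR_ge0.
  + by move=> x /itvN11[h1 h2]; apply: bound; lra.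
- apply: (@integrable_bounded_primitive _ _
    (fun x : R => - ((1 - x) `^ (a + 1) / (a + 1))) (2 `^ (a + 1) / (a + 1))).
  + move=> x /itvN11[h1 h2]; have := is_derive_powR_1Bx (a - 1) h1.
    by rewrite subrK => /is_derive_continuous.
  + move=> x /itvN11[h1 h2].
    under eq_fun do rewrite mulrC -mulNr.
    apply: (is_derive_eq (is_deriveZ (- (a + 1)^-1) (is_derive_powR_1Bx a h1))).
    by rewrite /GRing.scale/= mulrNN mulKf//; lra.
  + by move=> x _; exact: powR_ge0.
  + by move=> x /itvN11[h1 h2]; rewrite normrN; apply: bound; lra.
Qed.

Lemma bounded_horner q : exists M : R, forall x, x \in `]-1, 1[ -> `|q.[x]| <= M.
Proof.
exists (\sum_(i < size q) `|q`_i|) => x; rewrite in_itv/= => /andP[h1 h2].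
have x1 : `|x| <= 1 by rewrite ler_norml !ltW.
rewrite horner_coef (le_trans (ler_norm_sum _ _ _))//; apply: ler_sum => i _.
by rewrite normrM normrX ler_piMr// exprn_ile1.
Qed.

(** Each singularity is integrable on its own, and they are separated by
    w = (1 + x) w / 2 + (1 - x) w / 2: since a + 1 and b + 1 are positive,
    (1 + x)^(b + 1) <= 2^(b + 1) and (1 - x)^(a + 1) <= 2^(a + 1), whence
    w <= 2^b (1 - x)^a + 2^a (1 + x)^b. *)
Lemma integrable_jacobi_weight a b : -1 < a -> -1 < b ->
  mu.-integrable I (EFin \o jacobi_weight a b).
Proof.
move=> ha hb.
have i1 : mu.-integrable I (fun x => (2 `^ b)%:E * ((1 - x) `^ a)%:E)%E.
  by apply: integrableZl; [exact: measurable_itv|exact: (integrable_powR ha).2].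
have i2 : mu.-integrable I (fun x => (2 `^ a)%:E * ((1 + x) `^ b)%:E)%E.
  by apply: integrableZl; [exact: measurable_itv|exact: (integrable_powR hb).1].
apply: le_integrable (integrableD _ i1 i2) => //.
  apply/measurable_EFinP; apply: continuous_itv_measurable.
  exact: continuous_jacobi_weight.
move=> x xI /=; have [h1 h2] := itvN11 xI.
have pw (c y : R) : -1 < c -> 0 < y -> y < 2 -> y * y `^ c <= 2 * 2 `^ c.
  by move=> c1 y0 y2; rewrite -!powRD1//; apply: ge0_ler_powR; rewrite ?nnegrE; lra.
have := pw b (1 + x) hb h2 ltac:(lra); have := pw a (1 - x) ha h1 ltac:(lra).
have := powR_gt0 a h1; have := powR_gt0 b h2.
rewrite lee_fin !ger0_norm.
- rewrite /jacobi_weight.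
  set A := (1 - x) `^ a; set B := (1 + x) `^ b => B0 A0 hA hB.
  have e1 := ler_wpM2l (ltW A0) hB; have e2 := ler_wpM2l (ltW B0) hA; lra.
- by rewrite addr_ge0// mulr_ge0// powR_ge0.
- exact/ltW/jacobi_weight_gt0.
Qed.

Lemma integrable_horner_jacobi_weight a b q : -1 < a -> -1 < b ->
  mu.-integrable I (EFin \o (fun x => q.[x] * jacobi_weight a b x)).
Proof.
move=> ha hb.
have [M qM] := bounded_horner q.
have iM : mu.-integrable I (fun x => M%:E * (jacobi_weight a b x)%:E)%E.
  by apply: integrableZl; [exact: measurable_itv|exact: integrable_jacobi_weight].
apply: le_integrable iM => //.
  apply/measurable_EFinP; apply: continuous_itv_measurable.
  exact: continuous_horner_jacobi_weight.
move=> x xI /=; rewrite lee_fin normrM [leRHS]normrM ler_wpM2r//.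
by rewrite (le_trans (qM x xI))// ler_norm.
Qed.

Lemma cvg_horner_jacobi_weight_end a b q : 0 < a ->
  q.[exhaust_end R n] * jacobi_weight a b (exhaust_end R n) @[n --> \oo] --> (0 : R).
Proof.
move=> a0; rewrite /jacobi_weight.
have -> : (0 : R) = q.[1] * (0 * (1 + 1) `^ b) by rewrite mul0r mulr0.
have ce := @cvg_exhaust_end R.
apply: cvgM; first exact: (cvg_comp _ _ ce (@continuous_horner _ q 1)).
apply: cvgM.
  have E n : 1 - exhaust_end R n = n.+2%:R^-1 by rewrite /exhaust_end opprB addrC subrK.
  under eq_fun do rewrite E.
  move/cvg_at_rightP: (powR_cvg0 a0); apply; split; last exact: cvg_inv_natSS.
  by move=> n; rewrite invr_gt0.
have c2 : (fun y : R => (1 + y) `^ b) y @[y --> (1 : R)] --> (1 + 1 : R) `^ b.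
  have := @is_derive_powR_1Dx (b - 1) 1 ltac:(lra).
  by rewrite subrK => /is_derive_continuous.
exact: (cvg_comp _ _ ce c2).
Qed.

(** The integrand is the derivative of q times the weight of parameters
    a + 1 > 0 and b + 1 > 0, which vanishes at both ends. *)
Lemma integral_jacobi_pearson a b q : -1 < a -> -1 < b ->
  (\int[mu]_(x in I) ((jacobi_pearson a b q).[x] * jacobi_weight a b x)%:E = 0)%E.
Proof.
move=> ha hb.
pose F x := q.[x] * jacobi_weight (a + 1) (b + 1) x.
rewrite (@integral_primitive _ _ F 0 0) ?subrr//.
- exact: continuous_horner_jacobi_weight.
- by move=> x; exact: is_derive_horner_jacobi_weight.
- exact: integrable_horner_jacobi_weight.
- by apply: cvg_horner_jacobi_weight_end; lra.
(* The reflection x |-> - x exchanges the two ends and the two parameters. *)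
- have E n : F (- exhaust_end R n) = (q \Po (- 'X)).[exhaust_end R n] *
      jacobi_weight (b + 1) (a + 1) (exhaust_end R n).
    by rewrite /F jacobi_weightN horner_comp hornerN hornerX.
  under eq_fun do rewrite E.
  by apply: cvg_horner_jacobi_weight_end; lra.
Qed.

Lemma finite_roots p : p != 0 -> finite_set [set x | root p x].
Proof.
move=> p0; apply: contrapT => /(infinite_set_fset (size p)) [B Bp].
rewrite leqNgt => /negP; apply.
apply: max_poly_roots => //; last exact: finmap.fset_uniq.
by apply/allP => x /Bp.
Qed.

(** The integrand is nonnegative, hence zero almost everywhere; off the finitely
    many roots of p it is positive, so for p <> 0 the whole interval would be
    negligible. *)
Lemma integral_sqr_jacobi_weight_eq0 a b p : -1 < a -> -1 < b ->
  (\int[mu]_(x in I) ((p * p).[x] * jacobi_weight a b x)%:E = 0)%E -> p = 0.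
Proof.
move=> ha hb int0; apply/eqP/negP => /negP p0.
have mf : measurable_fun I (EFin \o (fun x => (p * p).[x] * jacobi_weight a b x)).
  apply/measurable_EFinP; apply: continuous_itv_measurable.
  exact: continuous_horner_jacobi_weight.
have : ae_eq mu I (EFin \o (fun x => (p * p).[x] * jacobi_weight a b x)) (cst 0%E).
  apply/ae_eq_integral_abs => //; rewrite -[RHS]int0; apply: eq_integral => x.
  rewrite inE => xI; rewrite /= ger0_norm// mulr_ge0//.
    by rewrite hornerM -expr2 sqr_ge0.
  exact/ltW/jacobi_weight_gt0.
move=> fN.
have rN : mu.-negligible [set x | root p x].
  have cr := finite_set_countable (finite_roots p0).
  apply/negligibleP; last exact: countable_lebesgue_measure0.
  by apply: countable_measurable.
have : mu I = 0%E.
  apply: measure_negligible; first exact: measurable_itv.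
  apply: negligibleS (negligibleU fN rN) => x xI.
  have [rx|nrx] := boolP (root p x); [by right|left => /= /(_ xI)].
  move=> [/eqP]; rewrite mulf_eq0 (gt_eqF (jacobi_weight_gt0 a b xI)) orbF.
  by rewrite hornerM mulf_eq0 orbb; exact/negP.
by rewrite lebesgue_measure_itv/= lte_fin ifT; [case; lra|lra].
Qed.

End JacobiWeight.

(** * The Jacobi functional and its orthogonal polynomials *)

Section JacobiFunctional.
Variable R : realType.
Local Notation mu := (@lebesgue_measure R).
Local Notation I := (`](-1)%R, 1%R[%classic : set R).
Implicit Types (p q r : {poly R}).

Section Functional.
Variables (a b : R) (ha : -1 < a) (hb : -1 < b).

(** The bounds on a and b are arguments because linearity holds only when all
    the integrals converge: a canonical linear structure has to find their
    proofs in the term. *)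
Definition jacobi_functional of -1 < a & -1 < b := fun p : {poly R} =>
  (\int[mu]_(x in I) (p.[x] * jacobi_weight a b x))%R.

Lemma jacobi_functionalE p :
  (\int[mu]_(x in I) (p.[x] * jacobi_weight a b x)%:E)%E =
  (jacobi_functional ha hb p)%:E.
Proof.
rewrite /jacobi_functional /Rintegral fineK//.
apply: integrable_fin_num; first exact: measurable_itv.
exact: integrable_horner_jacobi_weight.
Qed.

Lemma jacobi_functional_is_linear : scalar (jacobi_functional ha hb).
Proof.
move=> c p q; rewrite /jacobi_functional -RintegralZl.
- rewrite -RintegralD.
  + apply: eq_Rintegral => x _; rewrite hornerD hornerZ; ring.
  + exact: measurable_itv.
  + rewrite (_ : _ \o _ = EFin \o (fun x => (c *: p).[x] * jacobi_weight a b x)).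
      exact: integrable_horner_jacobi_weight.
    by apply/funext => x /=; rewrite hornerZ mulrA.
  + exact: integrable_horner_jacobi_weight.
- exact: measurable_itv.
- exact: integrable_horner_jacobi_weight.
Qed.

HB.instance Definition _ := GRing.isLinear.Build R {poly R} R *%R
  (jacobi_functional ha hb) jacobi_functional_is_linear.

Lemma jacobi_functional_definite p : jacobi_functional ha hb (p * p) = 0 -> p = 0.
Proof.
move=> h; apply: (integral_sqr_jacobi_weight_eq0 ha hb).
by rewrite jacobi_functionalE h.
Qed.

Lemma jacobi_functional_pearson r : jacobi_functional ha hb (jacobi_pearson a b r) = 0.
Proof. by apply/EFin_inj; rewrite -jacobi_functionalE integral_jacobi_pearson. Qed.

(** [monic_jacobi] is a choice, so only existence is at stake: Gram-Schmidt gives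
    the polynomials, and their square norms are nonzero by definiteness. *)
Lemma monic_jacobiP : is_monic_jacobi a b (monic_jacobi a b).
Proof.
rewrite /monic_jacobi; apply: (@xgetPex _ _ [set p | is_monic_jacobi a b p]).
have [p op] := choice (orthopoly_exists jacobi_functional_definite).
exists p; split; first by move=> n; have [? ? _] := op n.
move=> n m _ _ f.
have fE x : f x = ((p n * p m).[x] * jacobi_weight a b x)%:E by rewrite /f hornerM.
have -> : f = fun x => ((p n * p m).[x] * jacobi_weight a b x)%:E by apply/funext.
rewrite jacobi_functionalE; split.
- exact: integrable_horner_jacobi_weight.
- move=> nm; congr (_%:E).
  have [_ sn on] := op n; have [_ sm om] := op m.
  have [nm'|mn|//] := ltngtP n m.
    by rewrite mulrC om// sn.
  by rewrite on// sm.
- move=> <- [/jacobi_functional_definite pn0].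
  by have [_] := op n; rewrite pn0 size_poly0.
Qed.

Lemma monic_jacobi_orthopoly n :
  orthopoly (jacobi_functional ha hb) n (monic_jacobi a b n).
Proof.
have [hp orth] := monic_jacobiP; apply: orthopoly_pairwise => // i j ij.
have [_ /(_ ij) + _] := orth i j isT isT.
under eq_integral do rewrite -hornerM.
by rewrite jacobi_functionalE => -[].
Qed.

End Functional.

Lemma jacobi_functional_christoffel a b (ha : -1 < a) (hb : -1 < b)
    (hb1 : -1 < b + 1) p :
  jacobi_functional ha hb1 p = jacobi_functional ha hb (('X + 1) * p).
Proof.
apply: eq_Rintegral => x; rewrite inE => xI.
by rewrite jacobi_weightSr// hornerM hornerD hornerX hornerC; ring.
Qed.

End JacobiFunctional.

(** * Quasi-Christoffel Jacobi polynomials *)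

Theorem mainTheorem2 (R : realType) (alpha beta : R)
    (halpha : -1 < alpha) (hbeta : -1 < beta) :
  let lc := lambda_c alpha beta in
  let cc := c_c alpha beta in
  let lqc := lambda_qc alpha beta in
  let cqc := c_qc alpha beta in
  let g := gamma_qc alpha beta in
  let J := quasi_christoffel_jacobi alpha beta in
  [/\ forall n : nat, (2 <= n)%N ->
        cc n.+1 - cc n + g n - g n.+1 - lc n.+1 / g n + lc n / g n.-1 = 0,
      forall n : nat, (1 <= n)%N ->
        J n = ('X + 1) * monic_jacobi alpha (beta + 2) n.-1,
      forall n : nat, (2 <= n)%N ->
        J n.+1 = ('X - (cqc n.+1)%:P) * J n - lqc n.+1 *: J n.-1
    & orthogonal_family `]-1, 1[ (jacobi_weight alpha beta) 1 J].
Proof.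
move=> lc cc lqc cqc g J.
have h1 : -1 < beta + 1 by lra.
have h2 : -1 < beta + 2 by lra.
have h11 : -1 < beta + 1 + 1 by lra.
have E2 : beta + 1 + 1 = beta + 2 by ring.
have JE n : J n.+1 = ('X + 1) * monic_jacobi alpha (beta + 2) n.
  have n0 : 0 <= n%:R :> R by rewrite ler0n.
  rewrite -(jacobi_christoffel (a := alpha) (b := beta + 1)
    (@jacobi_functional_definite _ _ _ halpha h1)
    (jacobi_functional_pearson halpha h1)
    (@jacobi_functional_definite _ _ _ halpha h11)
    (jacobi_functional_pearson halpha h11)
    (jacobi_functional_christoffel halpha h1 h11) _ _
    (monic_jacobi_orthopoly halpha h1 n) (monic_jacobi_orthopoly halpha h1 n.+1)).
  - rewrite /J /quasi_christoffel_jacobi /gamma_qc -natr1 /=.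
    congr (_ + _ *: _).
    congr (_ / _); ring.
  - by rewrite gt_eqF//; lra.
  - by rewrite gt_eqF//; lra.
  - by rewrite -E2; exact: monic_jacobi_orthopoly.
split.
- case=> [|[|n]] // _.
  have n0 : 0 <= n%:R :> R by rewrite ler0n.
  rewrite /cc /lc /g /c_c /lambda_c /gamma_qc /= -!natr1.
  by field; rewrite !gt_eqF//; lra.
- by case=> // n _; exact: JE.
- case=> [|[|n]] // _; rewrite /= !JE.
  have n0 : 0 <= n%:R :> R by rewrite ler0n.
  rewrite (jacobi_recurrence (a := alpha) (b := beta + 2)
    (@jacobi_functional_definite _ _ _ halpha h2)
    (jacobi_functional_pearson halpha h2) _ _ _ _ _
    (monic_jacobi_orthopoly halpha h2 n) (monic_jacobi_orthopoly halpha h2 n.+1)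
    (monic_jacobi_orthopoly halpha h2 n.+2)).
  + rewrite mulrBr mulrCA -scalerAr; congr (_ - _ *: _).
    * congr ((_ - _%:P) * _); rewrite /cqc /c_qc /= -!natr1.
      congr (_ / _); ring.
    * rewrite /lqc /lambda_qc /= -!natr1; congr (_ / _); ring.
  + by rewrite gt_eqF//; lra.
  + by rewrite gt_eqF//; lra.
  + by rewrite gt_eqF//; lra.
  + by rewrite gt_eqF//; lra.
  + by rewrite gt_eqF//; lra.
- case=> // n [//|m] _ _ f.
  have [_ /(_ n m isT isT) []] := monic_jacobiP halpha h2.
  set I := `]-1, 1[%classic; set f' := (fun x => _) => int0 orth norm.
  have ff' : {in I, f =1 f'}.
    move=> x; rewrite inE => xI; rewrite /f /f' !JE -E2 !jacobi_weightSr//.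
    by rewrite !hornerM !hornerD !hornerX !hornerC; congr (_%:E); ring.
  have -> : (\int[@lebesgue_measure R]_(x in I) f x)%E =
      (\int[@lebesgue_measure R]_(x in I) f' x)%E by exact: eq_integral.
  split.
  + apply: eq_integrable int0; first exact: measurable_itv.
    by move=> x xI; rewrite ff'.
  + by move=> nm; apply: orth => nm'; apply: nm; rewrite nm'.
  + by move=> [nm]; apply: norm.
Qed.
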